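(* For $n\ge1$ and $l\in\{1,\dots,n\}$ let $X_{n,l}$ be the depth of the node containing $l$ in the random binary search tree built from a uniformly random permutation of $\{1,\dots,n\}$. Then $$\sup_{l\in\{1,\dots,n\}} d_{\mathrm{TV}}\big(\mathcal{L}(X_{n,l}),\ \mathrm{Po}(E X_{n,l})\big)\le \frac{28+\pi^2}{\log n}\qquad\text{for all } n\ge 2.$$
   Context: Random binary search tree: given a permutation $(\pi(1),\dots,\pi(n))$ of $\{1,\dots,n\}$, the keys are inserted in order $\pi(1),\pi(2),\dots$; $\pi(1)$ is the root, and each subsequent key moves left if smaller and right if larger than the current node's key, starting at the root, until it reaches an empty position where it is placed. The permutation is uniform over all $n!$ permutations. The depth of a node is its number of edges from the root. $\mathcal{L}(X)$ denotes the distribution of $X$. For probability measures $\mu,\nu$ on $\mathbb{N}_0$, $d_{\mathrm{TV}}(\mu,\nu)=\sup_{A\subset\mathbb{N}_0}|\mu(A)-\nu(A)|=\frac12\sum_{k\ge0}|\mu(\{k\})-\nu(\{k\})|$. $\mathrm{Po}(\lambda)$ is the Poisson distribution with mean $\lambda$, with $\mathrm{Po}(0)=\delta_0$. $\log$ is the natural logarithm. *)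

(* Defs.v *)
From mathcomp Require Import all_boot all_fingroup.
From Stdlib Require Import Reals.
From Coquelicot Require Import Coquelicot.

Set Implicit Arguments.
Unset Strict Implicit.
Unset Printing Implicit Defensive.

Inductive bst : Type :=
| Leaf : bst
| Node : bst -> nat -> bst -> bst.

Fixpoint bst_insert (x : nat) (t : bst) : bst :=
  match t with
  | Leaf => Node Leaf x Leaf
  | Node lt k rt =>
      if Nat.ltb x k then Node (bst_insert x lt) k rt
      else if Nat.ltb k x then Node lt k (bst_insert x rt)
      else t
  end.

(* Number of edges from the root to the node containing x
   (only meaningful when x is a key of t). *)
Fixpoint bst_depth (x : nat) (t : bst) : nat :=
  match t with
  | Leaf => 0%nat
  | Node lt k rt =>
      if Nat.ltb x k then S (bst_depth x lt)
      else if Nat.ltb k x then S (bst_depth x rt)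
      else 0%nat
  end.

Definition bst_of_seq (s : seq nat) : bst :=
  foldl (fun t x => bst_insert x t) Leaf s.

(* A permutation s of 'I_n encodes the permutation pi of {1..n} with
   pi(i+1) = s(i) + 1; keys inserted in order pi(1), ..., pi(n). *)
Definition perm_keys (n : nat) (s : 'S_n) : seq nat :=
  [seq (s i).+1 | i <- enum 'I_n].

Definition Xdepth (n l : nat) (s : 'S_n) : nat :=
  bst_depth l (bst_of_seq (perm_keys s)).

Definition X_pmf (n l k : nat) : R :=
  INR #|[set s : 'S_n | Xdepth l s == k]| / INR (n `!).

Definition X_mean (n l : nat) : R :=
  INR (\sum_(s : 'S_n) Xdepth l s) / INR (n `!).

(* Poisson(lambda) probability mass function (Po(0) = delta_0 since 0^0 = 1). *)
Definition poisson_pmf (lam : R) (k : nat) : R :=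
  exp (- lam) * lam ^ k / INR (Factorial.fact k).

Definition dTV (p q : nat -> R) : R :=
  / 2 * Series (fun k => Rabs (p k - q k)).

(* Main.v *)
(* Read the keys from the last inserted one: a key inserted after l does not change
   the depth of l, and a key y inserted before l is an ancestor of l iff no key inserted
   before y lies between them, i.e. y is the neighbour of l on its side. Hence, given that
   M and M' keys below and above l precede l, the depth is a sum of independent Bernoulli
   variables with parameters 1, 1/2, ..., 1/M and 1, 1/2, ..., 1/M'. The Stein solution g
   of an indicator function for Po(lam) has increments bounded by 1/lam. Conditioning on
   (M, M'), Stein's identity costs at most 4/lam (sums of squares of the parameters), and
   replacing the conditional mean H_M + H_M' by lam at most 12/lam, since M and M' are each
   uniform, so that H_a - H_M and H_b - H_M' have bounded second moments. As
   lam >= log n - 2, this gives the claim for log n > 28; otherwise it is trivial. *)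

Require Import Defs.
From HB Require Import structures.
From mathcomp Require Import all_boot all_fingroup zify.
From Stdlib Require Import Reals Lra Lia.
From Coquelicot Require Import Coquelicot.

(** * Insertion and depth in search trees *)

Local Open Scope nat_scope.

Fixpoint keys (t : bst) : seq nat :=
  if t is Node lt k rt then k :: keys lt ++ keys rt else [::].

Fixpoint is_bst (t : bst) : bool :=
  if t is Node lt k rt then
    [&& all (fun z => z < k) (keys lt), all (fun z => k < z) (keys rt),
        is_bst lt & is_bst rt]
  else true.

Lemma ltbP (m n : nat) : Nat.ltb m n = (m < n).
Proof. by apply/idP/idP => [/Nat.ltb_lt/ltP | /ltP/Nat.ltb_lt]. Qed.

Lemma keys_insert (y : nat) (t : bst) : keys (bst_insert y t) =i y :: keys t.
Proof.
elim: t => [|lt IHl k rt IHr] z //=.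
rewrite !ltbP; case: (ltngtP y k) => yk /=; rewrite !inE !mem_cat ?IHl ?IHr ?inE.
- by case: (z == k); case: (z == y); rewrite ?orbT.
- by case: (z == k); case: (z == y); rewrite ?orbT.
by rewrite yk; case: (z == k).
Qed.

Lemma is_bst_insert (y : nat) (t : bst) : is_bst t -> is_bst (bst_insert y t).
Proof.
elim: t => [|lt IHl k rt IHr] //= /and4P[ltk kgt bl br].
rewrite !ltbP; case: (ltngtP y k) => yk /=; rewrite ?ltk ?kgt ?bl ?br ?IHl ?IHr ?andbT //=.
- by rewrite (eq_all_r (keys_insert y lt)) /= yk.
- by rewrite (eq_all_r (keys_insert y rt)) /= yk.
Qed.

(** Insertion at most fills an empty position, so the path to a stored key is unchanged. *)
Lemma depth_insert_present (l y : nat) (t : bst) :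
  is_bst t -> l \in keys t -> bst_depth l (bst_insert y t) = bst_depth l t.
Proof.
elim: t => [|lt IHl k rt IHr] //= /and4P[/allP ltk /allP kgt bl br].
rewrite inE mem_cat !ltbP => lt_in.
case: (ltngtP y k) => yk //=; rewrite !ltbP; case: (ltngtP l k) lt_in => lk //= /orP[] lin.
- by rewrite IHl.
- by have := kgt _ lin; rewrite ltnNge ltnW.
- by have := ltk _ lin; rewrite ltnNge ltnW.
- by rewrite IHr.
Qed.

(** For an absent key, [bst_depth] returns the length of the search path to the empty position where
    that key would go. *)
Lemma depth_insert_self (l : nat) (t : bst) :
  bst_depth l (bst_insert l t) = bst_depth l t.
Proof.
elim: t => [|lt IHl k rt IHr] /=; first by rewrite ltbP ltnn.
rewrite !ltbP; case: (ltngtP l k) => lk /=; rewrite !ltbP.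
- by rewrite lk IHl.
- by rewrite lk ltnNge (ltnW lk) /= IHr.
by rewrite lk ltnn.
Qed.

Definition separates (l y z : nat) : bool := (l < z < y) || (y < z < l).

(** The search paths of [l] and [y] part at the first node whose key lies between them. If there is
    none, both end at the same empty position, and placing [y] there lengthens the path of [l] by
    one edge. *)
Lemma depth_insert_absent (l y : nat) (t : bst) :
  is_bst t -> l \notin keys t -> y \notin keys t -> y != l ->
  bst_depth l (bst_insert y t) = (bst_depth l t + ~~ has (separates l y) (keys t))%N.
Proof.
move=> + + + yl; elim: t => [|lt IHl k rt IHr] /=.
  by move=> _ _ _; rewrite !ltbP; case: ltngtP yl.
move=> /and4P[/allP ltk /allP kgt bl br].
rewrite !inE !mem_cat !negb_or has_cat => /and3P[lk ll lr] /and3P[yk y_l yr].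
rewrite !ltbP /separates.
case: (ltngtP y k) yk => yk //= _; rewrite !ltbP; case: (ltngtP l k) lk => lk //= _.
- rewrite IHl // addSn; congr (_ + ~~ _)%N.+1.
  rewrite [X in _ = _ || X](_ : _ = false) ?orbF //.
  apply/negbTE/hasPn => z /kgt kz; rewrite (ltnNge z y) (ltnNge z l).
  by rewrite (ltnW (ltn_trans yk kz)) (ltnW (ltn_trans lk kz)) !andbF.
- by rewrite addn0.
- by rewrite addn0.
rewrite IHr // addSn; congr (_ + ~~ _)%N.+1.
rewrite [X in _ = X || _](_ : _ = false) //.
apply/negbTE/hasPn => z /ltk kz; rewrite (ltnNge l z) (ltnNge y z).
by rewrite (ltnW (ltn_trans kz yk)) (ltnW (ltn_trans kz lk)).
Qed.

(* The head of [t] is the key inserted last. *)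
Definition depth_rev (l : nat) (t : seq nat) : nat := bst_depth l (bst_of_seq (rev t)).

Lemma bst_of_rev_cons (y : nat) (t : seq nat) :
  bst_of_seq (rev (y :: t)) = bst_insert y (bst_of_seq (rev t)).
Proof. by rewrite /bst_of_seq rev_cons foldl_rcons. Qed.

Lemma keys_bst_of_rev (t : seq nat) : keys (bst_of_seq (rev t)) =i t.
Proof.
elim: t => [|y t IH] z //; rewrite bst_of_rev_cons keys_insert !inE.
by rewrite IH.
Qed.

Lemma is_bst_of_rev (t : seq nat) : is_bst (bst_of_seq (rev t)).
Proof. by elim: t => [|y t IH] //; rewrite bst_of_rev_cons is_bst_insert. Qed.

Lemma depth_rev_present (l y : nat) (t : seq nat) :
  l \in t -> depth_rev l (y :: t) = depth_rev l t.
Proof.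
move=> lt; rewrite /depth_rev bst_of_rev_cons depth_insert_present ?is_bst_of_rev //.
by rewrite keys_bst_of_rev.
Qed.

Lemma depth_rev_self (l : nat) (t : seq nat) : depth_rev l (l :: t) = depth_rev l t.
Proof. by rewrite /depth_rev bst_of_rev_cons depth_insert_self. Qed.

Lemma depth_rev_absent (l y : nat) (t : seq nat) :
  l \notin t -> y \notin t -> y != l ->
  depth_rev l (y :: t) = (depth_rev l t + ~~ has (separates l y) t)%N.
Proof.
move=> lt yt yl; rewrite /depth_rev bst_of_rev_cons depth_insert_absent ?is_bst_of_rev //.
- by rewrite (eq_has_r (keys_bst_of_rev t)).
- by rewrite keys_bst_of_rev.
- by rewrite keys_bst_of_rev.
Qed.

Local Open Scope R_scope.

(** * Sums of independent Bernoulli variables and their mixtures *)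

(* Expectation of [f W] for [W] a sum of independent Bernoulli variables with
   success probabilities [ps]. *)
Fixpoint bern (ps : seq R) (f : nat -> R) : R :=
  if ps is p :: qs then p * bern qs (fun k => f k.+1) + (1 - p) * bern qs f
  else f O.

Definition sumR (ps : seq R) : R := foldr Rplus 0 ps.

Definition is_prob (p : R) : Prop := 0 <= p <= 1.

Lemma eq_bern (ps : seq R) (f g : nat -> R) : f =1 g -> bern ps f = bern ps g.
Proof.
elim: ps f g => [|p ps IH] f g fg /=; first exact: fg.
by rewrite (IH f g fg) (IH _ (fun k => g k.+1)) // => k; apply: fg.
Qed.

Lemma bern_lin (ps : seq R) (x y : R) (f g : nat -> R) :
  bern ps (fun k => x * f k + y * g k) = x * bern ps f + y * bern ps g.
Proof.
elim: ps f g => [|p ps IH] f g //=.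
rewrite (IH (fun k => f k.+1) (fun k => g k.+1)) IH; ring.
Qed.

Lemma bern_cst (ps : seq R) (c : R) : bern ps (fun=> c) = c.
Proof. by elim: ps => [|p ps IH] //=; rewrite IH; ring. Qed.

Lemma bern_mid (ps qs : seq R) (p : R) (f : nat -> R) :
  bern (ps ++ p :: qs) f = bern (p :: ps ++ qs) f.
Proof. by elim: ps f => [|q ps IH] f //=; rewrite !IH /=; ring. Qed.

Lemma bern_abs_le (ps : seq R) (f : nat -> R) (c : R) :
  List.Forall is_prob ps -> (forall k, Rabs (f k) <= c) -> Rabs (bern ps f) <= c.
Proof.
move=> pr; elim: pr f => [|p qs [p0 p1] _ IH] f fc //=.
have /Rabs_le_between h1 := IH _ (fun k => fc k.+1).
have /Rabs_le_between h2 := IH _ fc.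
by apply/Rabs_le_between; nra.
Qed.

Lemma bern_mean (ps : seq R) : bern ps INR = sumR ps.
Proof.
elim: ps => [|p ps IH] //=.
rewrite (eq_bern _ (fun k => INR k.+1) (fun k => 1 * INR k + 1 * 1)); last first.
  by move=> k; rewrite S_INR; ring.
rewrite bern_lin (bern_cst ps 1) IH; ring.
Qed.

(** With probability [p] the new variable raises the sum by one, which changes [g] by at most
    [c]. *)
Lemma bern_cons_diff (ps : seq R) (p c : R) (g : nat -> R) :
  List.Forall is_prob ps -> is_prob p ->
  (forall k, Rabs (g k.+1 - g k) <= c) ->
  Rabs (bern (p :: ps) g - bern ps g) <= p * c.
Proof.
move=> pr [p0 p1] gc /=.
have -> : p * bern ps (fun k => g k.+1) + (1 - p) * bern ps g - bern ps g
        = p * bern ps (fun k => 1 * g k.+1 + -1 * g k).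
  by rewrite bern_lin; ring.
rewrite Rabs_mult (Rabs_pos_eq p) //; apply: Rmult_le_compat_l => //.
apply: bern_abs_le => // k.
by have -> : 1 * g k.+1 + -1 * g k = g k.+1 - g k by ring.
Qed.

(** With [g k] in the role of the usual f(k+1), [lam * g k - stein_size_bias g k] is Stein's
    operator for Po(lam). At 0 the factor [INR k] kills the default value of the predecessor. *)
Definition stein_size_bias (g : nat -> R) (k : nat) : R := INR k * g k.-1.

(** In E[W g(W-1)] the variable with parameter p contributes p E g(W'), where W' is the sum without
    it; replacing W' by W costs at most p c, hence the squares. *)
Lemma bern_stein (ps : seq R) (c : R) (g : nat -> R) :
  List.Forall is_prob ps -> (forall k, Rabs (g k.+1 - g k) <= c) ->
  Rabs (sumR ps * bern ps g - bern ps (stein_size_bias g))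
    <= c * sumR [seq p * p | p <- ps].
Proof.
move=> pr; elim: pr g => [|p qs pp prs IH] g gc /=.
  by rewrite /stein_size_bias /= !Rmult_0_l Rmult_0_r Rminus_0_r Rabs_R0; apply: Rle_refl.
set gS := fun k => g k.+1.
have /Rabs_le_between h1 := IH gS (fun k => gc k.+1).
have /Rabs_le_between h2 := IH g gc.
have gc' k : Rabs (1 * gS k + -1 * g k) <= c.
  by have -> : 1 * gS k + -1 * g k = g k.+1 - g k by rewrite /gS; ring.
have /Rabs_le_between := bern_abs_le _ _ _ prs gc'.
rewrite bern_lin => h3.
have -> : bern qs (fun k => stein_size_bias g k.+1)
        = 1 * bern qs (stein_size_bias gS) + 1 * bern qs g.
  rewrite -bern_lin; apply: eq_bern => k; rewrite /stein_size_bias /gS S_INR /=.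
  by case: k => [|k] /=; ring.
case: pp => p0 p1; apply/Rabs_le_between; rewrite -!/(sumR _).
set x := bern qs gS in h1 h3 *; set y := bern qs g in h2 h3 *.
set u := bern qs (stein_size_bias gS) in h1 *.
set v := bern qs (stein_size_bias g) in h2 *.
set s := sumR qs in h1 h2 *; set t := sumR [seq _ | _ <- _] in h1 h2 *.
(* Conditioning on the first variable: the two inductive errors, plus its own error of size at most
   [p * p * c]. *)
have -> : (p + s) * (p * x + (1 - p) * y) - (p * (1 * u + 1 * y) + (1 - p) * v)
        = p * (s * x - u) + (1 - p) * (s * y - v) + p * p * (1 * x + -1 * y) by ring.
nra.
Qed.

(** * Harmonic parameters and the mixture over the numbers of earlier keys *)

Fixpoint harm (m : nat) : seq R :=
  if m is k.+1 then / INR k.+1 :: harm k else [::].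

Lemma INR_S_gt0 (n : nat) : 0 < INR n.+1.
Proof. exact/lt_0_INR/Nat.lt_0_succ. Qed.

Lemma invn_prob (n : nat) : is_prob (/ INR n.+1).
Proof.
split; first exact/Rlt_le/Rinv_0_lt_compat/INR_S_gt0.
rewrite -[X in _ <= X]Rinv_1; apply: Rinv_le_contravar; first lra.
by rewrite S_INR; have := pos_INR n; lra.
Qed.

Lemma harm_prob (m : nat) : List.Forall is_prob (harm m).
Proof. by elim: m => [|m IH] /=; constructor => //; apply: invn_prob. Qed.

Lemma sumR_cat (ps qs : seq R) : sumR (ps ++ qs) = sumR ps + sumR qs.
Proof. by elim: ps => [|p ps IH] /=; rewrite ?IH; ring. Qed.

Definition harmonic (m : nat) : R := sumR (harm m).

Lemma harmonicS (m : nat) : harmonic m.+1 = / INR m.+1 + harmonic m.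
Proof. by []. Qed.

Lemma harm_sumsq (m : nat) : sumR [seq p * p | p <- harm m] <= 2.
Proof.
have invx k : 0 < / INR k.+1 by apply/Rinv_0_lt_compat/INR_S_gt0.
case: m => [|m]; first by rewrite /=; lra.
(* Strengthened so that the induction telescopes: 1/(m+2)^2 <= 1/(m+1) - 1/(m+2). *)
suff : sumR [seq p * p | p <- harm m.+1] <= 2 - / INR m.+1 by have := invx m; lra.
elim: m => [|m IH]; first by rewrite /=; lra.
have -> : sumR [seq p * p | p <- harm m.+2]
        = / INR m.+2 * / INR m.+2 + sumR [seq p * p | p <- harm m.+1] by [].
have eqx : / INR m.+1 = / INR m.+2 + / INR m.+1 * / INR m.+2.
  by have := INR_S_gt0 m; rewrite (S_INR m.+1) => ?; field; lra.
have := invx m.+1; have : / INR m.+2 <= / INR m.+1.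
  by apply: Rinv_le_contravar; [exact: INR_S_gt0 | rewrite (S_INR m.+1); lra].
nra.
Qed.

(* For [N = a + b]: expectation of [phi M M'], where [M] and [M'] count the keys
   on either side of [l] that are inserted before [l], out of [a] and [b]; the
   recursion deletes the last inserted key. *)
Fixpoint mixture (N : nat) (phi : nat -> nat -> R) (a b : nat) : R :=
  if N is N'.+1 then
    (INR a * mixture N' phi a.-1 b + INR b * mixture N' phi a b.-1 + phi a b) / INR N.+1
  else phi a b.

Lemma mixtureS (N : nat) (phi : nat -> nat -> R) (a b : nat) :
  mixture N.+1 phi a b
  = (INR a * mixture N phi a.-1 b + INR b * mixture N phi a b.-1 + phi a b) / INR N.+2.
Proof. by []. Qed.

Lemma mixture_le (N : nat) (phi psi : nat -> nat -> R) (a b : nat) :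
  (forall i j, (i <= a)%nat -> (j <= b)%nat -> phi i j <= psi i j) ->
  mixture N phi a b <= mixture N psi a b.
Proof.
elim: N a b => [|N IH] a b le_ab; first exact: le_ab.
apply: Rmult_le_compat_r; first exact/Rlt_le/Rinv_0_lt_compat/INR_S_gt0.
apply: Rplus_le_compat; last exact: le_ab.
by apply: Rplus_le_compat; apply: Rmult_le_compat_l (pos_INR _) _;
  apply: IH => i j ia jb; apply: le_ab => //; apply: leq_trans (leq_pred _).
Qed.

Lemma eq_mixture (N : nat) (phi psi : nat -> nat -> R) (a b : nat) :
  (forall i j, (i <= a)%nat -> (j <= b)%nat -> phi i j = psi i j) ->
  mixture N phi a b = mixture N psi a b.
Proof.
by move=> e; apply: Rle_antisym; apply: mixture_le => i j ia jb;
  rewrite e //; apply: Rle_refl.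
Qed.

Lemma mixture_lin (N : nat) (x y : R) (phi psi : nat -> nat -> R) (a b : nat) :
  mixture N (fun i j => x * phi i j + y * psi i j) a b
  = x * mixture N phi a b + y * mixture N psi a b.
Proof.
elim: N a b => [|N IH] a b //=; rewrite !IH; field.
by have := INR_S_gt0 N.+1; rewrite /=; lra.
Qed.

(** Deleting one of the [b] keys reproduces the value [u a]; these terms cancel [b] of the a + b + 1
    weights and leave a recursion in [a] alone. *)
Lemma mixture_left (phi : nat -> R) (u : nat -> R) (a b : nat) :
  u 0%nat = phi 0%nat ->
  (forall m, INR m.+2 * u m.+1 = INR m.+1 * u m + phi m.+1) ->
  mixture (a + b) (fun i _ => phi i) a b = u a.
Proof.
move=> u0 uS; move eN : (a + b)%nat => N; elim: N a b eN => [|N IH] a b eN.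
  by case: a eN => [|a] // _; rewrite /= u0.
have N0 := INR_S_gt0 N.+1; rewrite /mixture -/mixture.
apply: (Rmult_eq_reg_r (INR N.+2)); last lra.
rewrite /Rdiv Rmult_assoc Rinv_l ?Rmult_1_r; last lra.
case: a eN => [|a] eN; case: b eN => [|b] eN //.
- rewrite (IH 0%nat b); last by case: eN.
  rewrite -[INR 0]/0 u0 -eN add0n.
  by rewrite (S_INR b.+1); ring.
- rewrite (IH a 0%nat); last by case: eN.
  by have := uS a; rewrite -eN addn0 -[INR 0]/0 !S_INR; lra.
- rewrite (IH a b.+1); last by case: eN.
  rewrite (IH a.+1 b); last by case: eN; rewrite addnS.
  by have := uS a; rewrite -eN !S_INR plus_INR !S_INR; lra.
Qed.

Lemma mixture_sym (N : nat) (phi : nat -> nat -> R) (a b : nat) :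
  mixture N phi a b = mixture N (fun i j => phi j i) b a.
Proof. by elim: N a b => [|N IH] a b //=; rewrite !IH; congr (_ / _); ring. Qed.

(** The number of the [a] keys preceding [l] is uniform on 0, ..., [a]: it is the position of [l],
    counted from 0, in the insertion order of these keys and [l]. *)
Lemma mixture_avg_left (phi : nat -> R) (a b : nat) :
  mixture (a + b) (fun i _ => phi i) a b = sum_f_R0 phi a / INR a.+1.
Proof.
apply: (mixture_left phi (fun m => sum_f_R0 phi m / INR m.+1)) => [|m] /=; first by field.
by rewrite -!/(INR m.+1) -/(INR m.+2); field; split; apply: Rgt_not_eq; apply: INR_S_gt0.
Qed.

Lemma mixture_avg_right (phi : nat -> R) (a b : nat) :
  mixture (a + b) (fun _ j => phi j) a b = sum_f_R0 phi b / INR b.+1.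
Proof. by rewrite mixture_sym addnC mixture_avg_left. Qed.

Lemma mixture_cst (c : R) (a b : nat) : mixture (a + b) (fun _ _ => c) a b = c.
Proof. by rewrite mixture_avg_left sum_cte; field; apply: Rgt_not_eq; apply: INR_S_gt0. Qed.

(** * Gaps between harmonic numbers, and the mean depth *)

Lemma harmonic_incr (i a : nat) : (i <= a)%nat -> harmonic i <= harmonic a.
Proof.
elim: a => [|a IH]; first by rewrite leqn0 => /eqP ->; apply: Rle_refl.
rewrite leq_eqVlt => /orP[/eqP -> | /IH le_i]; first exact: Rle_refl.
by rewrite harmonicS; have [] := invn_prob a; lra.
Qed.

(** The term 1/m occurs in the gaps of all i < m, so each m from 1 to [a] contributes 1 in total. *)
Lemma sum_harmonic_gap (a : nat) : sum_f_R0 (fun i => harmonic a - harmonic i) a = INR a.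
Proof.
elim: a => [|a IH]; first by rewrite /=; lra.
rewrite tech5 (sum_eq _ (fun i => (harmonic a - harmonic i) + / INR a.+1)); last first.
  by move=> i _; rewrite harmonicS; ring.
rewrite sum_plus IH sum_cte [INR a.+1 in RHS]S_INR; field.
by have := INR_S_gt0 a; lra.
Qed.

(** Raising [a] by one adds 2a/(a+1) + 1/(a+1) <= 2, by the linear sum just computed. *)
Lemma sum_harmonic_gap_sq (a : nat) :
  sum_f_R0 (fun i => (harmonic a - harmonic i) ^ 2) a <= 2 * INR a.
Proof.
elim: a => [|a IH]; first by rewrite /=; lra.
rewrite tech5 (sum_eq _ (fun i => ((harmonic a - harmonic i) ^ 2
                            + (harmonic a - harmonic i) * (2 * / INR a.+1))
                         + (/ INR a.+1) ^ 2)); last first.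
  by move=> i _; rewrite harmonicS; ring.
rewrite !sum_plus sum_cte -scal_sum sum_harmonic_gap.
have a1 := INR_S_gt0 a; rewrite S_INR in a1 *.
have -> : INR a = (INR a + 1) - 1 by ring.
have -> : INR a + 1 - 1 + 1 = INR a + 1 by ring.
set x := INR a + 1 in a1 *; have -> : harmonic a.+1 - harmonic a.+1 = 0 by ring.
have : 0 < / x by apply: Rinv_0_lt_compat.
have : 2 * / x * (x - 1) + (/ x) ^ 2 * x = 2 - / x by field; lra.
have : INR a = x - 1 by rewrite /x; ring.
lra.
Qed.

Lemma avg_le (s c : R) (a : nat) : s <= c * INR a -> 0 <= c -> s / INR a.+1 <= c.
Proof.
move=> sc c0; apply/Rle_div_l; first exact: INR_S_gt0.
by rewrite S_INR; nra.
Qed.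

Lemma bern_catC (ps qs : seq R) (f : nat -> R) : bern (ps ++ qs) f = bern (qs ++ ps) f.
Proof.
elim: ps f => [|p ps IH] f; first by rewrite cats0.
by rewrite bern_mid /= !IH.
Qed.

(** The parameters 1/(i+1), ..., 1/a are added one at a time, each at a cost of [c] times itself. *)
Lemma bern_harm_lip (ps : seq R) (c : R) (g : nat -> R) (i a : nat) :
  List.Forall is_prob ps -> (forall k, Rabs (g k.+1 - g k) <= c) -> (i <= a)%nat ->
  Rabs (bern (harm i ++ ps) g - bern (harm a ++ ps) g) <= c * (harmonic a - harmonic i).
Proof.
move=> pr gc; elim: a => [|a IH].
  by rewrite leqn0 => /eqP ->; rewrite !Rminus_diag Rabs_R0 Rmult_0_r; apply: Rle_refl.
rewrite leq_eqVlt => /orP[/eqP -> | /IH le_i].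
  by rewrite !Rminus_diag Rabs_R0 Rmult_0_r; apply: Rle_refl.
have prc : List.Forall is_prob (harm a ++ ps).
  by apply/List.Forall_app; split => //; apply: harm_prob.
have := bern_cons_diff _ _ _ _ prc (invn_prob a) gc.
rewrite harmonicS -/(harm a.+1 ++ ps) -cat_cons -/(harm a.+1).
move: le_i => /Rabs_le_between h1 /Rabs_le_between h2.
by apply/Rabs_le_between; lra.
Qed.

Definition depth_mean (a b : nat) : R := mixture (a + b) (fun i j => harmonic i + harmonic j) a b.

(** For uniform [i] the mean of [harmonic a - harmonic i] is a/(a+1), which lies between 0 and 1. *)
Lemma depth_mean_gap (a b : nat) :
  harmonic a + harmonic b - 2 <= depth_mean a b <= harmonic a + harmonic b.
Proof.
have e : depth_mean a b
    = 1 * (harmonic a + harmonic b) + -1 * (INR a / INR a.+1 + INR b / INR b.+1).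
  rewrite -(mixture_cst (harmonic a + harmonic b) a b).
  rewrite -[in INR a / _]sum_harmonic_gap -[in INR b / _]sum_harmonic_gap.
  rewrite -(mixture_avg_left _ a b) -(mixture_avg_right _ a b).
  rewrite -[X in _ = _ + -1 * (X + _)]Rmult_1_l -[X in _ = _ + -1 * (_ + X)]Rmult_1_l.
  by rewrite -!mixture_lin; apply: eq_mixture => i j _ _; ring.
have frac m : 0 <= INR m / INR m.+1 <= 1.
  split; first by apply: Rdiv_le_0_compat; [exact: pos_INR | exact: INR_S_gt0].
  by apply: avg_le; lra.
by have := frac a; have := frac b; lra.
Qed.

Lemma ln_le_harmonic (m : nat) : ln (INR m.+1) <= harmonic m.
Proof.
elim: m => [|m IH]; first by rewrite ln_1; apply: Rle_refl.
have m0 := INR_S_gt0 m; rewrite harmonicS.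
have -> : INR m.+2 = INR m.+1 * (1 + / INR m.+1) by rewrite (S_INR m.+1); field; lra.
have x0 : 0 < / INR m.+1 by apply: Rinv_0_lt_compat.
rewrite ln_mult //; last lra.
suff : ln (1 + / INR m.+1) <= / INR m.+1 by lra.
by rewrite -[X in _ <= X]ln_exp; apply: ln_le; [lra | exact: exp_ineq1_le].
Qed.

(** Rests on a + b + 1 <= (a + 1)(b + 1). *)
Lemma ln_le_depth_mean (a b : nat) : ln (INR (a + b).+1) - 2 <= depth_mean a b.
Proof.
suff : ln (INR (a + b).+1) <= ln (INR a.+1) + ln (INR b.+1).
  by have := ln_le_harmonic a; have := ln_le_harmonic b; have := depth_mean_gap a b; lra.
rewrite -ln_mult; try exact: INR_S_gt0.
apply: ln_le; first exact: INR_S_gt0.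
by rewrite !S_INR plus_INR; have := pos_INR a; have := pos_INR b; nra.
Qed.

(* Conditionally on [(i, j)] the Stein error is at most [c] times a sum of squares;
   the remaining covariance of the conditional mean with [bern _ g] is controlled by
   the second moments of [harmonic a - harmonic i] and [harmonic b - harmonic j]. *)
Lemma mixture_stein (a b : nat) (c : R) (g : nat -> R) :
  (forall k, Rabs (g k.+1 - g k) <= c) ->
  mixture (a + b) (fun i j => bern (harm i ++ harm j)
    (fun k => depth_mean a b * g k - stein_size_bias g k)) a b <= 16 * c.
Proof.
move=> gc; set lam := depth_mean a b.
have c0 : 0 <= c by have := gc 0%nat; have := Rabs_pos (g 1%nat - g 0%nat); lra.
set V := fun i j => bern (harm i ++ harm j) g.
pose u i := harmonic a - harmonic i; pose v j := harmonic b - harmonic j.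
have Vlip i j : (i <= a)%nat -> (j <= b)%nat -> Rabs (V i j - V a b) <= c * (u i + v j).
  move=> ia jb.
  have /Rabs_le_between h1 := bern_harm_lip _ _ _ _ _ (harm_prob j) gc ia.
  have /Rabs_le_between := bern_harm_lip _ _ _ _ _ (harm_prob a) gc jb.
  rewrite !(bern_catC _ (harm a)) -!/(V _ _) => h2; move: h1; rewrite -!/(V _ _) => h1.
  by apply/Rabs_le_between; rewrite /u /v; lra.
(* With h = [harmonic i + harmonic j], Stein's identity costs [4 * c], and (lam - h) V(i,j) is split
   at [V a b]. Multiplying |lam - h| <= u + v + 2 by |V(i,j) - V(a,b)| <= c (u + v) and using (u +
   v)^2 <= 2 u^2 + 2 v^2 gives the first summand. *)
pose B i j := c * ((2 * (u i) ^ 2 + 2 * u i) + (2 * (v j) ^ 2 + 2 * v j))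
              + (lam * V a b + 4 * c - V a b * (harmonic i + harmonic j)).
apply: (@Rle_trans _ (mixture (a + b) B a b)).
  apply: mixture_le => i j ia jb.
  rewrite (eq_bern _ _ (fun k => lam * g k + -1 * stein_size_bias g k)); last by move=> k; ring.
  rewrite bern_lin -/(V i j).
  have prc : List.Forall is_prob (harm i ++ harm j).
    by apply/List.Forall_app; split; apply: harm_prob.
  have /Rabs_le_between := bern_stein _ _ _ prc gc.
  rewrite map_cat !sumR_cat -!/(harmonic _) -/(V i j).
  have := harm_sumsq i; have := harm_sumsq j.
  have /Rabs_le_between := Vlip _ _ ia jb.
  have := harmonic_incr _ _ ia; have := harmonic_incr _ _ jb.
  have := depth_mean_gap a b; rewrite -/lam /B.
  have -> : harmonic i = harmonic a - u i by rewrite /u; ring.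
  have -> : harmonic j = harmonic b - v j by rewrite /v; ring.
  move: (u i) (v j) (V i j) (V a b) (bern _ (stein_size_bias g)) => y z w w0 t.
  move: (sumR _) (sumR _) => s1 s2 lamb z0 y0 wb s1b s2b tb.
  have : c * (s1 + s2) <= 4 * c by nra.
  have e : (lam - (harmonic a - y + (harmonic b - z))) * (w - w0) <= (y + z + 2) * (c * (y + z)).
    apply: Rle_trans (Rle_abs _) _; rewrite Rabs_mult.
    by apply: Rmult_le_compat; try exact: Rabs_pos; apply/Rabs_le_between; lra.
  have := Rmult_le_pos _ _ c0 (pow2_ge_0 (y - z)); nra.
pose M := mixture (a + b).
have Mu1 : M (fun i _ => u i) a b <= 1.
  by rewrite /M mixture_avg_left; apply: avg_le; rewrite /u ?sum_harmonic_gap; lra.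
have Mv1 : M (fun _ j => v j) a b <= 1.
  by rewrite /M mixture_avg_right; apply: avg_le; rewrite /v ?sum_harmonic_gap; lra.
have Mu2 : M (fun i _ => u i ^ 2) a b <= 2.
  by rewrite /M mixture_avg_left; apply: avg_le; [exact: sum_harmonic_gap_sq | lra].
have Mv2 : M (fun _ j => v j ^ 2) a b <= 2.
  by rewrite /M mixture_avg_right; apply: avg_le; [exact: sum_harmonic_gap_sq | lra].
pose w i j := (2 * (u i) ^ 2 + 2 * u i) + (2 * (v j) ^ 2 + 2 * v j).
have Mw : M w a b <= 12.
  have -> : M w a b = 1 * (2 * M (fun i _ => u i ^ 2) a b + 2 * M (fun i _ => u i) a b)
              + 1 * (2 * M (fun _ j => v j ^ 2) a b + 2 * M (fun _ j => v j) a b).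
    by rewrite /M -!mixture_lin; apply: eq_mixture => i j _ _; rewrite /w; ring.
  lra.
(* As [lam] is the mixture of [harmonic i + harmonic j], the terms in [V a b] average to zero; what
   remains is at most 12 c + 4 c. *)
have -> : mixture (a + b) B a b
    = c * M w a b + 1 * (1 * (lam * V a b + 4 * c) + - V a b * lam).
  rewrite {2}/lam /depth_mean -(mixture_cst (lam * V a b + 4 * c) a b) /M -!mixture_lin.
  by apply: eq_mixture => i j _ _; rewrite /B /w; ring.
nra.
Qed.

(** * Stein's equation for the Poisson distribution *)

Lemma poisson_pmfS (lam : R) (k : nat) :
  INR k.+1 * poisson_pmf lam k.+1 = lam * poisson_pmf lam k.
Proof.
rewrite /poisson_pmf fact_simpl mult_INR -tech_pow_Rmult.
field; split; [exact: INR_fact_neq_0 | exact: not_0_INR].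
Qed.

Lemma poisson_pmf_gt0 (lam : R) (k : nat) : 0 < lam -> 0 < poisson_pmf lam k.
Proof.
move=> lam0; apply: Rdiv_lt_0_compat; last exact: INR_fact_lt_0.
by apply: Rmult_lt_0_compat; [exact: exp_pos | exact: pow_lt].
Qed.

Lemma poisson_pmf_series (lam : R) : is_series (poisson_pmf lam) 1.
Proof.
have h := is_exp_Reals lam.
apply: (is_series_ext (fun k =>
  scal (exp (- lam)) (scal (pow_n lam k) (/ INR (Factorial.fact k))))).
  by move=> k; rewrite /scal /= /mult /= /poisson_pmf pow_n_pow /Rdiv -Rmult_assoc.
have -> : 1 = scal (exp (- lam)) (exp lam).
  by rewrite /scal /= /mult /= -exp_plus Rplus_opp_l exp_0.
exact: is_series_scal.
Qed.

Section SteinEquation.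

Variables (lam : R) (alpha : nat -> R) (K : nat).
Hypotheses (lam0 : 0 < lam) (alpha01 : forall k, 0 <= alpha k <= 1).
Hypothesis alpha_supp : forall k, (K < k)%nat -> alpha k = 0.

Let q := poisson_pmf lam.
Let Q := sum_f_R0 q.
Let u := sum_f_R0 (fun i => alpha i * q i).
Let T k := 1 - Q k.

(** Since [alpha] vanishes beyond [K], [u K] is the Poisson mean of [alpha], and the numerator is
    the partial sum of (alpha - u K) q up to [k]. *)
Definition stein_sol (k : nat) : R := (u k - u K * Q k) / (lam * q k).

(** By the recursion for [q] both terms have denominator [q k], and the difference of the partial
    sums is a single term. *)
Lemma stein_sol_eq (k : nat) :
  lam * stein_sol k - INR k * stein_sol k.-1 = alpha k - u K.
Proof.
have q0 i : q i <> 0 by apply/Rgt_not_eq/poisson_pmf_gt0.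
case: k => [|k]; rewrite /stein_sol /u /Q /=.
  by field; split; [exact: q0 | lra].
rewrite -/(INR k.+1) -/u -/Q.
have e : lam * q k = INR k.+1 * q k.+1 by rewrite /q poisson_pmfS.
have k0 : INR k.+1 <> 0 by apply: not_0_INR.
rewrite e; field; repeat split => //; lra.
Qed.

Let q_gt0 i : 0 < q i := poisson_pmf_gt0 lam i lam0.

Let Q_lim : is_lim_seq Q 1.
Proof.
have := poisson_pmf_series lam; rewrite /is_series => h.
by apply: (is_lim_seq_ext (sum_n q)) => [n|]; [exact: sum_n_Reals | exact: h].
Qed.

Let Q_incr i j : (i <= j)%nat -> Q i <= Q j.
Proof.
elim: j => [|j IH]; first by rewrite leqn0 => /eqP ->; apply: Rle_refl.
rewrite leq_eqVlt => /orP[/eqP -> | /IH le_i]; first exact: Rle_refl.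
by rewrite /Q tech5 -/Q; have := q_gt0 j.+1; lra.
Qed.

Let Q_le1 i : Q i <= 1.
Proof.
by apply: (is_lim_seq_incr_compare Q 1) => // n; apply: Q_incr.
Qed.

Let Q_ge0 i : 0 <= Q i.
Proof. by apply: cond_pos_sum => j; apply: Rlt_le. Qed.

Let aq k : 0 <= alpha k * q k <= q k.
Proof. by have := alpha01 k; have := q_gt0 k; nra. Qed.

Let uQ_incr i j : (i <= j)%nat -> u i <= u j /\ Q i - u i <= Q j - u j.
Proof.
elim: j => [|j IH]; first by rewrite leqn0 => /eqP ->; lra.
rewrite leq_eqVlt => /orP[/eqP -> | /IH le_i]; first by lra.
by rewrite /u /Q !tech5 -/u -/Q; have := aq j.+1; lra.
Qed.

Let u_const j : (K <= j)%nat -> u j = u K.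
Proof.
elim: j => [|j IH]; first by rewrite leqn0 => /eqP ->.
rewrite leq_eqVlt => /orP[/eqP -> // | Kj].
by rewrite /u tech5 -/u IH // alpha_supp //; lra.
Qed.

Let u_bounds k : 0 <= u k <= Q k /\ 0 <= u K - u k <= T k.
Proof.
have u0 : 0 <= u k by apply: cond_pos_sum => j; case: (aq j).
have uQ : u k <= Q k by apply: sum_Rle => j _; case: (aq j).
(* [u K] is read at [maxn k K], which is beyond the support and at least [k]. *)
split=> //; rewrite -(u_const (maxn k K)) ?leq_maxr //.
by have [] := uQ_incr _ _ (leq_maxl k K); have := Q_le1 (maxn k K); rewrite /T; lra.
Qed.

(* [(1 - Q k) / q k] is decreasing. *)
Let tail_ratio k : INR k.+1 * T k.+1 <= lam * T k.
Proof.
(* Termwise, (k+1) q(j+1) <= (j+1) q(j+1) = lam q(j) for j > k; letting [N] tend to infinity turns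
   the sums into tails. *)
have sh N : INR k.+1 * (Q (N + k).+1 - Q k.+1) <= lam * (Q (N + k)%nat - Q k).
  elim: N => [|N IH]; first by rewrite add0n; lra.
  rewrite addSn /Q (tech5 _ (N + k)%nat) (tech5 _ (N + k).+1) -/Q.
  have := poisson_pmfS lam (N + k).+1; rewrite -/q.
  have : INR k.+1 <= INR (N + k).+2 by apply/le_INR/leP; rewrite !ltnS -addSn leq_addl.
  have := q_gt0 (N + k).+2; nra.
have l1 : is_lim_seq (fun N => lam * (Q (N + k)%nat - Q k)) (lam * T k).
  apply: (is_lim_seq_scal_l _ lam (T k)).
  apply: is_lim_seq_minus'; last exact: is_lim_seq_const.
  exact: (proj1 (is_lim_seq_incr_n Q k 1) Q_lim).
have l2 : is_lim_seq (fun N => INR k.+1 * (Q (N + k).+1 - Q k.+1)) (INR k.+1 * T k.+1).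
  apply: (is_lim_seq_scal_l _ (INR k.+1) (T k.+1)).
  apply: is_lim_seq_minus'; last exact: is_lim_seq_const.
  exact: (proj1 (is_lim_seq_incr_n (fun N => Q N.+1) k 1) (proj1 (is_lim_seq_incr_1 Q 1) Q_lim)).
exact: (is_lim_seq_le _ _ (Finite _) (Finite _) sh l2 l1).
Qed.

(* [Q k / q k] is increasing. *)
Let head_ratio k : lam * Q k <= INR k.+1 * (Q k.+1 - q 0%nat).
Proof.
elim: k => [|k IH].
  by rewrite /Q /=; have := poisson_pmfS lam 0; rewrite -/q /=; lra.
have := poisson_pmfS lam k.+1; rewrite /Q !tech5 -/Q -/q in IH * => e.
have Q0 : 0 <= Q k + q k.+1 - q 0%nat.
  have := Q_incr 0 k isT; rewrite /Q /= -/Q; have := q_gt0 k.+1; lra.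
rewrite (S_INR k.+1) in e *; have := INR_S_gt0 k; nra.
Qed.

(* Separating the atoms below, at and above [k.+1], only the atom at [k.+1] contributes
   positively to the increment, and the total over all atoms is zero. *)
Lemma stein_sol_lip (k : nat) : Rabs (stein_sol k.+1 - stein_sol k) <= / lam.
Proof.
have [[u1 u2] [v1 v2]] := u_bounds k; have [[u1' u2'] [v1' v2']] := u_bounds k.+1.
have tr := tail_ratio k; have hr := head_ratio k.
have e := poisson_pmfS lam k; rewrite -/q in e.
have k0 := INR_S_gt0 k; have q1 := q_gt0 k.+1; have q0 := q_gt0 k.
have eQ : Q k.+1 = Q k + q k.+1 by [].
have eu : u k.+1 = u k + alpha k.+1 * q k.+1 by [].
have := aq k.+1; set d := alpha k.+1 * q k.+1 in eu * => d01.
have -> : stein_sol k.+1 - stein_sol k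
   = (INR k.+1 * (u k.+1 - u K * Q k.+1) - lam * (u k - u K * Q k)) / (lam * (INR k.+1 * q k.+1)).
  rewrite /stein_sol; have -> : q k.+1 = lam * q k / INR k.+1 by rewrite -e; field; lra.
  by field; repeat split; lra.
have mq : 0 < INR k.+1 * q k.+1 by nra.
set num := _ - _.
(* The coefficients of [u k] and [u K - u k.+1] are nonpositive by the tail and head ratios, that of
   [d] is nonnegative. *)
have numE : num = u k * (INR k.+1 * T k.+1 - lam * T k) + d * (INR k.+1 * T k.+1 + lam * Q k)
                 + (u K - u k.+1) * (lam * Q k - INR k.+1 * Q k.+1).
  by rewrite /num /T eu; ring.
have hr' : lam * Q k <= INR k.+1 * Q k.+1 by have := q_gt0 0%nat; nra.
have T0 : 0 <= T k.+1 by lra.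
have mT : INR k.+1 * T k.+1 + lam * Q k <= INR k.+1.
  by move: hr'; rewrite /T; lra.
have s0 : 0 <= INR k.+1 * T k.+1 + lam * Q k by have := Q_ge0 k; nra.
have up : num <= INR k.+1 * q k.+1.
  have : d * (INR k.+1 * T k.+1 + lam * Q k) <= q k.+1 * INR k.+1 by apply: Rmult_le_compat; lra.
  by rewrite numE; nra.
have lo : - (INR k.+1 * q k.+1) <= num.
  have h1 : Q k * (INR k.+1 * T k.+1 - lam * T k) <= u k * (INR k.+1 * T k.+1 - lam * T k) by nra.
  have h2 : T k.+1 * (lam * Q k - INR k.+1 * Q k.+1)
            <= (u K - u k.+1) * (lam * Q k - INR k.+1 * Q k.+1) by nra.
  have h3 : 0 <= d * (INR k.+1 * T k.+1 + lam * Q k) by nra.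
  have h4 : q k.+1 * (INR k.+1 * T k.+1 + lam * Q k) <= q k.+1 * INR k.+1.
    by apply: Rmult_le_compat_l; lra.
  (* The case of [alpha] constantly 1: the two negative terms at their extremes balance the middle
     one at its largest. *)
  have : Q k * (INR k.+1 * T k.+1 - lam * T k) + T k.+1 * (lam * Q k - INR k.+1 * Q k.+1)
     = - (q k.+1 * (INR k.+1 * T k.+1 + lam * Q k)) by rewrite /T eQ; ring.
  by rewrite numE; lra.
rewrite Rabs_div; last by nra.
rewrite (Rabs_pos_eq (lam * _)); last by nra.
apply/Rle_div_l; first by nra.
have -> : / lam * (lam * (INR k.+1 * q k.+1)) = INR k.+1 * q k.+1 by field; lra.
exact/Rabs_le_between.
Qed.

End SteinEquation.

(** * The law of the depth *)

HB.instance Definition _ := Monoid.isComLaw.Build R 0 Rplus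
  (fun x y z => esym (Rplus_assoc x y z)) Rplus_comm Rplus_0_l.

Lemma bigR_scal (I : Type) (r : seq I) (P : pred I) (c : R) (F : I -> R) :
  \big[Rplus/0]_(i <- r | P i) (c * F i) = c * \big[Rplus/0]_(i <- r | P i) F i.
Proof.
by rewrite (big_morph (Rmult c) (Rmult_plus_distr_l c) (Rmult_0_r c)).
Qed.

Lemma bigR_const (I : Type) (r : seq I) (P : pred I) (c : R) :
  \big[Rplus/0]_(i <- r | P i) c = INR (count P r) * c.
Proof.
rewrite big_const_seq; elim: (count P r) => [|m IH]; first by rewrite /= Rmult_0_l.
by rewrite iterS IH S_INR; ring.
Qed.

Lemma ex_argmin (L : seq nat) (d : nat -> nat) :
  L != [::] -> exists2 y, y \in L & all (fun z => d y <= d z)%nat L.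
Proof.
elim: L => [|x L IH] // _; case: (eqVneq L [::]) => [-> | /IH[y yL /allP ymin]].
  by exists x; rewrite ?mem_head //= leqnn.
case: (leqP (d x) (d y)) => xy.
  exists x; rewrite ?mem_head //= leqnn /=; apply/allP => z /ymin.
  exact: leq_trans.
exists y; rewrite ?inE ?yL ?orbT //= (ltnW xy).
exact/allP.
Qed.

(** Injectivity of [d] leaves exactly one entry of a nonempty list with no smaller one. *)
Lemma sum_argmin (L : seq nat) (d : nat -> nat) (F : bool -> R) :
  uniq L -> {in L &, injective d} ->
  \big[Rplus/0]_(y <- L) F (~~ has (fun z => d z < d y)%nat L)
  = if size L is m.+1 then F true + INR m * F false else 0.
Proof.
move=> uL dinj; case: (eqVneq L [::]) => [-> | L0]; first by rewrite big_nil.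
have [y yL /allP ymin] := ex_argmin L d L0.
rewrite (bigD1_seq y) //= [has _ _](_ : _ = false) /=; last first.
  by apply/negbTE/hasPn => z /ymin; rewrite -leqNgt.
rewrite big_seq_cond (eq_bigr (fun=> F false)); last first.
  move=> z /andP[zL zy]; congr F; apply/negbTE; rewrite negbK; apply/hasP; exists y => //.
  by rewrite ltn_neqAle ymin // andbT; apply: contraNneq zy => /dinj ->.
rewrite -big_seq_cond bigR_const -size_filter -rem_filter // size_rem //.
by case: L yL {uL dinj L0 ymin}.
Qed.

(** * Sums over all orderings of a list of keys *)

Definition perm_total (s : seq nat) (F : seq nat -> R) : R :=
  \big[Rplus/0]_(t <- permutations s) F t.

Lemma perm_total_cons (s : seq nat) (F : seq nat -> R) :
  uniq s -> (0 < size s)%nat ->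
  perm_total s F
  = \big[Rplus/0]_(y <- s) perm_total (rem y s) (fun t => F (y :: t)).
Proof.
move=> us s0; rewrite /perm_total (perm_big _ (permutationsE s0)) undup_id //.
exact: big_allpairs_dep.
Qed.

Lemma eq_perm_total (s : seq nat) (F G : seq nat -> R) :
  (forall t, perm_eq t s -> F t = G t) -> perm_total s F = perm_total s G.
Proof.
move=> FG; rewrite /perm_total big_seq [RHS]big_seq; apply: eq_bigr => t.
by rewrite mem_permutations; apply: FG.
Qed.

Definition below (l : nat) (s : seq nat) : nat := count (fun y => y < l)%nat s.
Definition above (l : nat) (s : seq nat) : nat := count (fun y => l < y)%nat s.

Lemma size_below_above (l : nat) (s : seq nat) :
  l \notin s -> size s = (below l s + above l s)%nat.
Proof.
move=> ls; rewrite -(count_predC (fun y => y < l)%nat); congr (_ + _)%nat.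
apply: eq_in_count => y ys /=; rewrite -leqNgt leq_eqVlt; case: eqP => // e.
by rewrite e ys in ls.
Qed.

Lemma below_rem (l y : nat) (s : seq nat) :
  y \in s -> below l (rem y s) = (below l s - (y < l))%nat.
Proof. by move=> ys; rewrite /below count_rem ys. Qed.

Lemma above_rem (l y : nat) (s : seq nat) :
  y \in s -> above l (rem y s) = (above l s - (l < y))%nat.
Proof. by move=> ys; rewrite /above count_rem ys. Qed.

Lemma big_below_above (l : nat) (s : seq nat) (F : nat -> R) :
  l \notin s ->
  \big[Rplus/0]_(y <- s) F y = \big[Rplus/0]_(y <- s | (y < l)%nat) F y
                             + \big[Rplus/0]_(y <- s | (l < y)%nat) F y.
Proof.
move=> ls; rewrite (bigID (fun y => y < l)%nat) /=; congr (_ + _).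
rewrite big_seq_cond [RHS]big_seq_cond; apply: eq_bigl => y.
case ys: (y \in s) => //=; rewrite -leqNgt leq_eqVlt; case: eqP => // e.
by rewrite e ys in ls.
Qed.

(** Lets the neighbour test for the last key [y] be made in the whole list, which does not vary with
    [y]. *)
Lemma has_separates_rem (l y : nat) (s : seq nat) :
  has (separates l y) (rem y s) = has (separates l y) s.
Proof.
have yy : ~~ separates l y y by rewrite /separates !ltnn andbF.
case ys: (y \in s); last by rewrite rem_id // ys.
by rewrite (perm_has _ (perm_to_rem ys)) /= (negbTE yy).
Qed.

Lemma sum_nearest_below (l : nat) (s : seq nat) (F : bool -> R) :
  uniq s ->
  \big[Rplus/0]_(y <- s | (y < l)%nat) F (~~ has (separates l y) s)
  = if below l s is m.+1 then F true + INR m * F false else 0.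
Proof.
(* Below [l] the truncated difference [l - y] is injective and is least at the neighbour of [l]. *)
move=> us; rewrite /below -size_filter -(sum_argmin _ (fun y => l - y)%nat); last first.
- move=> y z; rewrite !mem_filter => /andP[yl _] /andP[zl _] /eqP.
  by rewrite eqn_sub2lE ?(ltnW yl) ?(ltnW zl) // => /eqP.
- exact: filter_uniq.
rewrite big_filter; apply: eq_bigr => y yl; congr (F (~~ _)).
rewrite [RHS]has_filter -filter_predI -has_filter; apply: eq_has => z /=.
by rewrite /separates; lia.
Qed.

Lemma sum_nearest_above (l : nat) (s : seq nat) (F : bool -> R) :
  uniq s ->
  \big[Rplus/0]_(y <- s | (l < y)%nat) F (~~ has (separates l y) s)
  = if above l s is m.+1 then F true + INR m * F false else 0.
Proof.
move=> us; rewrite /above -size_filter -(sum_argmin _ (fun y => y)) //; last exact: filter_uniq.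
rewrite big_filter; apply: eq_bigr => y yl; congr (F (~~ _)).
rewrite [RHS]has_filter -filter_predI -has_filter; apply: eq_has => z /=.
by rewrite /separates; lia.
Qed.

Lemma INR_factS (n : nat) : INR (n.+1)`! = INR n.+1 * INR n`!.
Proof. by rewrite factS mult_INR. Qed.

(** The parameter 1/(m+1) gives the weights 1 and [m] of the neighbour and of the other keys on one
    side. *)
Lemma bern_harmS (m : nat) (ps : seq R) (f : nat -> R) :
  INR m.+1 * bern (harm m.+1 ++ ps) f
  = bern (harm m ++ ps) (fun k => f k.+1) + INR m * bern (harm m ++ ps) f.
Proof. by rewrite /= -/(INR m.+1) S_INR; field; have := INR_S_gt0 m; rewrite S_INR; lra. Qed.

(** Condition on the last inserted key. Of m+1 keys on one side only the neighbour of [l] lengthens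
    its search path, which is the Bernoulli variable of parameter 1/(m+1); either side thus
    reproduces the same expectation, and the weights add up to the size. *)
Lemma perm_total_absent (l : nat) (s : seq nat) (f : nat -> R) :
  uniq s -> l \notin s ->
  perm_total s (fun t => f (depth_rev l t))
  = INR (size s)`! * bern (harm (below l s) ++ harm (above l s)) f.
Proof.
move eN: (size s) => N; elim: N s f eN => [|N IH] s f eN us ls.
  by case: s eN us ls => // _ _ _; rewrite /perm_total big_seq1 fact0 /depth_rev /=; ring.
rewrite perm_total_cons ?eN //.
pose c y := ~~ has (separates l y) s.
pose G i j (b : bool) := bern (harm i ++ harm j) (fun k => f (k + b)%nat).
have step y : y \in s ->
    perm_total (rem y s) (fun t => f (depth_rev l (y :: t)))
    = INR N`! * G (below l s - (y < l))%nat (above l s - (l < y))%nat (c y).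
  move=> ys; rewrite -below_rem // -above_rem // -(IH (rem y s) (fun k => f (k + c y)%nat)).
  - apply: eq_perm_total => t tp; rewrite depth_rev_absent ?(perm_mem tp).
    + by rewrite (perm_has _ tp) has_separates_rem.
    + by apply: contra ls => /mem_rem.
    + by rewrite mem_rem_uniq // inE eqxx.
    + by apply: contraNneq ls => <-.
  - by rewrite size_rem // eN.
  - exact: rem_uniq.
  - by apply: contra ls => /mem_rem.
rewrite big_seq (eq_bigr _ step) -big_seq bigR_scal (big_below_above l) //.
rewrite (eq_bigr (fun y => G (below l s).-1 (above l s) (c y))); last first.
  by move=> y yl; rewrite yl ltnNge (ltnW yl) subn1 subn0.
rewrite (sum_nearest_below _ _ (G (below l s).-1 (above l s))) //.
rewrite (eq_bigr (fun y => G (below l s) (above l s).-1 (c y))); last first.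
  by move=> y yl; rewrite yl ltnNge (ltnW yl) subn1 subn0.
rewrite (sum_nearest_above _ _ (G (below l s) (above l s).-1)) //.
have G1 i j : G i j true = bern (harm i ++ harm j) (fun k => f k.+1).
  by apply: eq_bern => k; rewrite addn1.
have G0 i j : G i j false = bern (harm i ++ harm j) f.
  by apply: eq_bern => k; rewrite addn0.
have left_sum i j : (if i is m.+1 then G i.-1 j true + INR m * G i.-1 j false else 0)
                  = INR i * bern (harm i ++ harm j) f.
  by case: i => [|i]; rewrite ?Rmult_0_l // bern_harmS G1 G0.
have right_sum i j : (if j is m.+1 then G i j.-1 true + INR m * G i j.-1 false else 0)
                  = INR j * bern (harm i ++ harm j) f.
  case: j => [|j]; rewrite ?Rmult_0_l // bern_catC bern_harmS G1 G0 succnK.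
  by rewrite !(bern_catC (harm j)).
rewrite left_sum right_sum INR_factS -eN (size_below_above _ _ ls) plus_INR; ring.
Qed.

Lemma perm_total_perm (s r : seq nat) (F : seq nat -> R) :
  perm_eq s r -> perm_total s F = perm_total r F.
Proof. by move=> /perm_permutations; apply: perm_big. Qed.

(** Keys inserted after [l] leave its depth alone, so deleting them follows the recursion of
    [mixture]; when [l] itself comes last, the absent case applies. *)
Lemma perm_total_present (l : nat) (s : seq nat) (f : nat -> R) :
  uniq s -> l \notin s ->
  perm_total (l :: s) (fun t => f (depth_rev l t))
  = INR (size s).+1`! *
    mixture (size s) (fun i j => bern (harm i ++ harm j) f) (below l s) (above l s).
Proof.
move eN: (size s) => N; elim: N s eN => [|N IH] s eN us ls.
  case: s eN us ls => // _ _ _; rewrite perm_total_cons // big_seq1 /= eqxx.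
  by rewrite /perm_total big_seq1 depth_rev_self Rmult_1_l.
rewrite perm_total_cons ?cons_uniq ?ls // big_cons.
have -> : rem l (l :: s) = s by rewrite /= eqxx.
rewrite (eq_perm_total _ _ (fun t => f (depth_rev l t))); last first.
  by move=> t _; rewrite depth_rev_self.
rewrite perm_total_absent // eN.
set phi := fun i j => bern (harm i ++ harm j) f.
pose M i j := mixture N phi i j.
have step y : y \in s ->
    perm_total (rem y (l :: s)) (fun t => f (depth_rev l (y :: t)))
    = INR N.+1`! * M (below l s - (y < l))%nat (above l s - (l < y))%nat.
  move=> ys; have -> : rem y (l :: s) = l :: rem y s.
    by rewrite /=; case: eqP => // ly; rewrite ly ys in ls.
  rewrite -below_rem // -above_rem // -IH.
  - apply: eq_perm_total => t tp; rewrite depth_rev_present //.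
    by rewrite (perm_mem tp) mem_head.
  - by rewrite size_rem // eN.
  - exact: rem_uniq.
  - by apply: contra ls => /mem_rem.
rewrite big_seq (eq_bigr _ step) -big_seq bigR_scal (big_below_above l) //.
rewrite (eq_bigr (fun y => M (below l s).-1 (above l s))); last first.
  by move=> y yl; rewrite yl ltnNge (ltnW yl) subn1 subn0.
rewrite [X in _ * (_ + X)](eq_bigr (fun y => M (below l s) (above l s).-1)); last first.
  by move=> y yl; rewrite yl ltnNge (ltnW yl) subn1 subn0.
rewrite !bigR_const -/(below l s) -/(above l s) (INR_factS N.+1) mixtureS -!/(M _ _).
by rewrite -/(phi _ _); field; have := INR_S_gt0 N.+1; lra.
Qed.

(** An injective family of n! orderings of n distinct keys exhausts them all. *)
Lemma perm_keys_perm (n : nat) :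
  perm_eq [seq perm_keys s | s <- enum 'S_n] (permutations (seq.iota 1 n)).
Proof.
have inj : injective (@perm_keys n).
  move=> s t /eq_in_map e; apply/permP => i.
  by apply/val_inj; have [] := e i (mem_enum _ i).
have sub : {subset [seq perm_keys s | s <- enum 'S_n] <= permutations (seq.iota 1 n)}.
  move=> _ /mapP[s _ ->]; rewrite mem_permutations; apply: uniq_perm; last 1 first.
  - move=> k; rewrite mem_iota; apply/mapP/idP => [[i _ ->] | /andP[k0 kn]].
      by rewrite add1n !ltnS leq0n; apply: ltn_ord.
    have kn' : (k.-1 < n)%nat by lia.
    exists ((s^-1)%g (Ordinal kn')); first by rewrite mem_enum.
    by rewrite permKV /= prednK.
  - by rewrite map_inj_uniq ?enum_uniq // => i j [] /val_inj /perm_inj.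
  - exact: iota_uniq.
have un : uniq [seq perm_keys s | s <- enum 'S_n].
  by rewrite map_inj_uniq ?enum_uniq.
apply: uniq_perm => //; first exact: permutations_uniq.
have sz : (size (permutations (seq.iota 1 n)) <= size [seq perm_keys s | s <- enum 'S_n])%nat.
  by rewrite size_permutations ?iota_uniq // size_iota size_map -cardE card_Sn.
by have [] := uniq_min_size un sub sz.
Qed.

Lemma sum_Xdepth (n l : nat) :
  (0 < l)%nat -> (l <= n)%nat ->
  exists a b : nat, (a + b).+1%nat = n /\
    forall f : nat -> R, \big[Rplus/0]_(s : 'S_n) f (Xdepth l s)
    = INR n`! * mixture (a + b) (fun i j => bern (harm i ++ harm j) f) a b.
Proof.
move=> l0 ln; pose s := rem l (seq.iota 1 n).
have lin : l \in seq.iota 1 n by rewrite mem_iota l0 add1n ltnS.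
have us : uniq s by rewrite rem_uniq ?iota_uniq.
have ls : l \notin s by rewrite mem_rem_uniq ?iota_uniq // inE eqxx.
have sz : size s = n.-1 by rewrite size_rem // size_iota.
have n0 : (0 < n)%nat by apply: leq_trans ln.
exists (below l s), (above l s); rewrite -size_below_above // sz prednK //; split=> // f.
transitivity (perm_total (l :: s) (fun t => f (depth_rev l t))); last first.
  by rewrite perm_total_present // sz prednK.
rewrite -(perm_total_perm _ _ _ (perm_to_rem lin)).
transitivity (perm_total (seq.iota 1 n) (fun t => f (bst_depth l (bst_of_seq t)))).
  rewrite /perm_total -(perm_big _ (perm_keys_perm n)) /= big_map big_enum /=.
  exact: eq_bigr.
rewrite /perm_total /depth_rev.
(* Reversal permutes the orderings, so summing over insertion orders equals summing over reversed
   ones. *)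
have rev_perm : perm_eq [seq rev t | t <- permutations (seq.iota 1 n)]
                        (permutations (seq.iota 1 n)).
  apply: uniq_perm; first by rewrite (map_inj_uniq (can_inj revK)) permutations_uniq.
    exact: permutations_uniq.
  move=> t; rewrite -[t in LHS]revK (mem_map (can_inj revK)) !mem_permutations.
  by rewrite perm_rev.
rewrite -(perm_big _ rev_perm) /= big_map.
by [].
Qed.

(** * Total variation *)

Lemma is_series_finite (f : nat -> R) (K : nat) :
  (forall k, (K < k)%nat -> f k = 0) -> is_series f (sum_f_R0 f K).
Proof.
move=> f0; have e : forall N, (K <= N)%nat -> sum_n f N = sum_f_R0 f K.
  elim=> [|N IH]; first by rewrite leqn0 => /eqP ->; rewrite sum_n_Reals.
  rewrite leq_eqVlt => /orP[/eqP -> | KN]; first by rewrite sum_n_Reals.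
  by rewrite sum_Sn IH // f0 // /plus /= Rplus_0_r.
apply: (is_lim_seq_ext_loc (fun=> sum_f_R0 f K) (sum_n f) (sum_f_R0 f K)).
  by exists K => N /leP /e.
exact: is_lim_seq_const.
Qed.

(** The supremum is attained on the set where [q k < p k], which lies within [K]; equal masses make
    the sum of |p - q| twice that of the positive parts. *)
Lemma dTV_one_sided (p q : nat -> R) (K : nat) :
  (forall k, 0 <= q k) -> is_series q 1 ->
  (forall k, (K < k)%nat -> p k = 0) -> sum_f_R0 p K = 1 ->
  exists alpha : nat -> R,
    [/\ forall k, 0 <= alpha k <= 1, forall k, (K < k)%nat -> alpha k = 0
      & dTV p q = sum_f_R0 (fun k => alpha k * (p k - q k)) K].
Proof.
move=> q0 q1 pK p1.
pose alpha k := if Rlt_dec (q k) (p k) then 1 else 0.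
have alpha0 k : (K < k)%nat -> alpha k = 0.
  by move=> /pK pk; rewrite /alpha pk; case: Rlt_dec => // qk; have := q0 k; lra.
exists alpha; split=> //; first move=> k.
  by rewrite /alpha; case: (Rlt_dec (q k) (p k)) => ? /=; lra.
pose f k := alpha k * (p k - q k).
have sf : is_series f (sum_f_R0 f K).
  by apply: is_series_finite => k /alpha0 ak; rewrite /f ak Rmult_0_l.
have sp : is_series p 1 by rewrite -p1; apply: is_series_finite.
have : is_series (fun k => Rabs (p k - q k)) (2 * sum_f_R0 f K - 1 + 1).
  apply: (is_series_ext (fun k => plus (minus (scal 2 (f k)) (p k)) (q k))).
    move=> k; rewrite -[LHS]/(2 * f k - p k + q k) /f /alpha.
    by case: (Rlt_dec (q k) (p k)) => pq /=; [rewrite Rabs_pos_eq | rewrite Rabs_left1]; lra.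
  by apply: is_series_plus => //; apply: is_series_minus => //; apply: is_series_scal_l.
by move=> /is_series_unique; rewrite /dTV => ->; rewrite -/f; field.
Qed.

(** * Expectations under the law of the depth *)

Lemma INR_sum (I : finType) (P : pred I) (F : I -> nat) :
  INR (\sum_(i | P i) F i) = \big[Rplus/0]_(i | P i) INR (F i).
Proof. exact: (big_morph INR plus_INR (erefl (INR 0))). Qed.

Lemma sum_f_R0_big (f : nat -> R) (m : nat) :
  sum_f_R0 f m = \big[Rplus/0]_(k < m.+1) f k.
Proof.
elim: m => [|m IH]; first by rewrite big_ord_recr big_ord0 /= Rplus_0_l.
by rewrite big_ord_recr /= IH.
Qed.

Lemma X_pmf_big (n l k : nat) :
  X_pmf n l k = (\big[Rplus/0]_(s : 'S_n) (if Xdepth l s == k then 1 else 0)) / INR n`!.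
Proof.
rewrite /X_pmf -sum1_card INR_sum; congr (_ / _).
by rewrite -big_mkcond; apply: eq_bigl => s; rewrite inE.
Qed.

Lemma X_pmf_out (n l k : nat) : (\max_(s : 'S_n) Xdepth l s < k)%nat -> X_pmf n l k = 0.
Proof.
move=> Kk; rewrite X_pmf_big big1 ?Rdiv_0_l // => s _.
by case: eqP => // e; move: Kk; rewrite -e ltnNge (@leq_bigmax _ (fun r : 'S_n => Xdepth l r)).
Qed.

(** Exchanging the two sums; truncation at the largest depth loses no mass. *)
Lemma sum_X_pmf (n l : nat) (f : nat -> R) :
  sum_f_R0 (fun k => f k * X_pmf n l k) (\max_(s : 'S_n) Xdepth l s)
  = (\big[Rplus/0]_(s : 'S_n) f (Xdepth l s)) / INR n`!.
Proof.
set K := \max_(s : _) _; rewrite sum_f_R0_big.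
under eq_bigr => k _ do rewrite X_pmf_big Rmult_comm /Rdiv Rmult_assoc Rmult_comm -bigR_scal.
rewrite exchange_big /= /Rdiv Rmult_comm -bigR_scal; apply: eq_bigr => s _.
have sK : (Xdepth l s < K.+1)%nat by rewrite ltnS (@leq_bigmax _ (fun r : 'S_n => Xdepth l r)).
rewrite (bigD1 (Ordinal sK)) //= eqxx big1 => [|k ks]; first by rewrite Rplus_0_r Rmult_1_r.
rewrite ifN ?Rmult_0_r //; apply: contraNneq ks => e.
by apply/eqP/val_inj; rewrite /= e.
Qed.

Theorem theorem3 :
  forall n : nat, leq 2 n ->
  forall l : nat, leq 1 l -> leq l n ->
    (dTV (X_pmf n l) (poisson_pmf (X_mean n l))
       <= (28 + PI ^ 2) / ln (INR n))%R.
Proof.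
move=> n n2 l l1 ln_.
have [a [b [abn sumE]]] := sum_Xdepth n l l1 ln_.
set K := \max_(s : 'S_n) Xdepth l s.
pose E f := mixture (a + b) (fun i j => bern (harm i ++ harm j) f) a b.
have fact0 : INR n`! <> 0 by apply/not_0_INR => /eqP; rewrite eqn0Ngt fact_gt0.
have pmfE f : sum_f_R0 (fun k => f k * X_pmf n l k) K = E f.
  by rewrite sum_X_pmf sumE /E; field.
have meanE : X_mean n l = depth_mean a b.
  rewrite /X_mean INR_sum sumE /depth_mean.
  rewrite (eq_mixture _ _ (fun i j => harmonic i + harmonic j)); first by field.
  by move=> i j _ _; rewrite bern_mean sumR_cat.
have cstE c : E (fun=> c) = c.
  rewrite -[RHS](mixture_cst c a b); apply: eq_mixture => i j _ _.
  exact: bern_cst.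
rewrite meanE; set lam := depth_mean a b.
have lam_ge0 : 0 <= lam.
  rewrite -(mixture_cst 0 a b); apply: mixture_le => i j _ _.
  by have := harmonic_incr 0 i isT; have := harmonic_incr 0 j isT; rewrite /harmonic /=; lra.
have q0 k : 0 <= poisson_pmf lam k.
  apply: Rmult_le_pos; last exact/Rlt_le/Rinv_0_lt_compat/INR_fact_lt_0.
  by apply: Rmult_le_pos; [exact/Rlt_le/exp_pos | exact: pow_le].
have p1 : sum_f_R0 (X_pmf n l) K = 1.
  rewrite -(cstE 1) -pmfE; apply: sum_eq => k _; ring.
have [alpha [a01 a_supp ->]] :=
  dTV_one_sided _ _ _ q0 (poisson_pmf_series lam) (X_pmf_out n l) p1.
have n_gt1 : 1 < INR n by apply: (lt_INR 1); apply/ltP.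
have L0 : 0 < ln (INR n) by rewrite -ln_1; apply: ln_increasing; lra.
apply/Rle_div_r => //.
have pi0 := pow2_ge_0 PI.
(* For ln n <= 28 it suffices that the distance is at most 1. *)
case: (Rle_lt_dec (ln (INR n)) 28) => L28.
  apply: Rle_trans (_ : 1 * ln (INR n) <= _); last lra.
  apply: Rmult_le_compat_r; first exact: Rlt_le.
  rewrite -p1; apply: sum_Rle => k _.
  have p0 : 0 <= X_pmf n l k.
    by apply: Rdiv_le_0_compat; [exact: pos_INR | have := pos_INR n`!; lra].
  by have := a01 k; have := q0 k; nra.
have lamL : ln (INR n) - 2 <= lam by rewrite -abn; apply: ln_le_depth_mean.
have lam0 : 0 < lam by lra.
pose g := stein_sol lam alpha K.
have glip := stein_sol_lip lam alpha K lam0 a01 a_supp.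
have := mixture_stein a b (/ lam) g glip; rewrite -/lam.
(* By Stein's equation the integrand is [alpha k] minus the Poisson mean of [alpha], so the mixture
   is the discrepancy picked out by [alpha]. *)
have -> : mixture (a + b) (fun i j => bern (harm i ++ harm j)
    (fun k => lam * g k - stein_size_bias g k)) a b
  = sum_f_R0 (fun k => alpha k * (X_pmf n l k - poisson_pmf lam k)) K.
  rewrite (sum_eq _ (fun k => alpha k * X_pmf n l k - alpha k * poisson_pmf lam k)); last first.
    by move=> k _; ring.
  rewrite minus_sum pmfE.
  set u := sum_f_R0 _ _.
  have -> : E alpha - u = 1 * E alpha + -1 * E (fun=> u) by rewrite cstE; ring.
  rewrite -mixture_lin; apply: eq_mixture => i j _ _; rewrite -bern_lin.
  apply: eq_bern => k; rewrite /stein_size_bias /g (stein_sol_eq lam alpha K lam0).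
  by rewrite -/u; ring.
(* As lam >= ln n - 2, it is enough that 16 ln n <= 28 (ln n - 2), that is ln n >= 14/3. *)
move=> bound; have : 16 * / lam * ln (INR n) <= 28.
  have -> : 16 * / lam * ln (INR n) = 16 * ln (INR n) / lam by field; lra.
  by apply/Rle_div_l => //; lra.
move=> le28; apply: Rle_trans (_ : 16 * / lam * ln (INR n) <= _); last lra.
by apply: Rmult_le_compat_r; [exact: Rlt_le | exact: bound].
Qed.
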